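(* Let $\mathcal{E}$ be a topological VE-space over the topologically ordered $*$-space $Z$ and let $p\in S(Z)$. Then $$p([e,f])\le 4\,p([e,e])^{1/2}p([f,f])^{1/2}=4\,\tilde{p}(e)\,\tilde{p}(f),\quad e,f\in\mathcal{E},$$ where $\tilde{p}(h)=p([h,h])^{1/2}$ for $h\in\mathcal{E}$.
   Context: Ordered $*$-space: a complex vector space $Z$ with (a1) an involution $z\mapsto z^*$ that is conjugate linear and satisfies $(z^* )^*=z$; (a2) a convex cone $Z_+\subseteq Z$ ($sx+ty\in Z_+$ for all real $s,t\ge 0$ and $x,y\in Z_+$) that is strict ($Z_+\cap -Z_+=\{0\}$) and consists of selfadjoint elements only. One writes $z_1\ge z_2$ if $z_1-z_2\in Z_+$. $Z$ is topologically ordered if moreover (a3) $Z$ is a Hausdorff locally convex space; (a4) $Z_+$ is closed; (a5) the topology has a base linearly generated by a family of neighbourhoods of $0$ that are absolutely convex and solid ($x\in N$ and $0\le y\le x$ imply $y\in N$); equivalently, the topology is defined by a family of seminorms $p$ that are increasing ($0\le x\le y$ implies $p(x)\le p(y)$). $S(Z)$ denotes the collection of all increasing continuous seminorms on $Z$. VE-space over $Z$: a complex vector space $\mathcal{E}$ with a $Z$-valued inner product $[\cdot,\cdot]\colon\mathcal{E}\times\mathcal{E}\to Z$ such that $[x,x]\ge 0$ with $[x,x]=0$ iff $x=0$; $[x,y]=[y,x]^*$; and $[\cdot,\cdot]$ is linear in the second variable. When $Z$ is topologically ordered, $\mathcal{E}$ with the Hausdorff locally convex topology defined by the seminorms $h\mapsto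 p([h,h])^{1/2}$, $p\in S(Z)$, is called a topological VE-space over $Z$. *)

(* Defs.v *)
From HB Require Import structures.
From mathcomp Require Import all_boot all_order all_algebra.
From mathcomp Require Import all_classical all_reals all_analysis.
From mathcomp Require Export complex.

Set Implicit Arguments.
Unset Strict Implicit.
Unset Printing Implicit Defensive.

Import Order.TTheory GRing.Theory Num.Theory.
Import numFieldTopology.Exports.

Local Open Scope classical_set_scope.
Local Open Scope ring_scope.
Local Open Scope complex_scope.

HB.mixin Record Lmodule_isOrderedStar (R : realType) Z & GRing.Lmodule R[i] Z := {
  star : Z -> Z ;
  starK : involutive star ;
  star_conj_linear : forall (a : R[i]) (x y : Z),
    star (a *: x + y) = a^*%C *: star x + star y ;
  zpos : set Z ;
  zpos_cone : forall (s t : R) (x y : Z), 0 <= s -> 0 <= t ->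
    zpos x -> zpos y -> zpos (s%:C *: x + t%:C *: y) ;
  zpos_strict : zpos `&` -%R @` zpos = [set 0] ;
  zpos_selfadjoint : forall x : Z, zpos x -> star x = x
}.

#[short(type="orderedStarType")]
HB.structure Definition OrderedStar (R : realType) :=
  {Z of GRing.Lmodule R[i] Z & Lmodule_isOrderedStar R Z}.

Definition zle (R : realType) (Z : orderedStarType R) (x y : Z) : Prop :=
  zpos (y - x).

Definition absolutely_convex (R : realType) (V : lmodType R[i]) (N : set V) :
    Prop :=
  forall (a b : R[i]) (x y : V), `|a| + `|b| <= 1 ->
    N x -> N y -> N (a *: x + b *: y).

Definition solid (R : realType) (Z : orderedStarType R) (N : set Z) : Prop :=
  forall x y : Z, N x -> zle 0 y -> zle y x -> N y.

HB.mixin Record OrderedStar_isTopOrdered (R : realType) Z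
    & Tvs R[i] Z & OrderedStar R Z := {
  hausdorffZ : hausdorff_space Z ;
  closed_zpos : closed (zpos : set Z) ;
  (* The positive multiples of the members of the family are a base of
     neighbourhoods of [0]; by translation they determine the topology. *)
  solid_base : exists B : set_system Z,
    (forall N, B N -> [/\ nbhs 0 N, absolutely_convex N & solid N]) /\
    (forall U : set Z, nbhs 0 U -> exists (N : set Z) (t : R),
      [/\ B N, 0 < t & [set t%:C *: x | x in N] `<=` U])
}.

#[short(type="topOrderedStarType")]
HB.structure Definition TopOrderedStar (R : realType) :=
  {Z of Tvs R[i] Z & OrderedStar R Z & OrderedStar_isTopOrdered R Z}.

Definition seminorm (R : realType) (V : lmodType R[i]) (p : V -> R) : Prop :=
  [/\ forall x, 0 <= p x,
      forall x y, p (x + y) <= p x + p y &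
      forall (a : R[i]) x, (p (a *: x))%:C = `|a| * (p x)%:C].

Definition increasing (R : realType) (Z : orderedStarType R) (p : Z -> R) :
    Prop :=
  forall x y, zle 0 x -> zle x y -> p x <= p y.

Definition incr_seminorms (R : realType) (Z : topOrderedStarType R) : set (Z -> R) :=
  [set p | [/\ seminorm p, increasing p & continuous p]].
Arguments incr_seminorms {R} Z.

HB.mixin Record Lmodule_isVE (R : realType) (Z : orderedStarType R) E
    & GRing.Lmodule R[i] E := {
  ip : E -> E -> Z ;
  ip_ge0 : forall x, zle 0 (ip x x) ;
  ip_eq0 : forall x, ip x x = 0 <-> x = 0 ;
  ip_star : forall x y, ip x y = star (ip y x) ;
  ip_linear : forall x (a : R[i]) y z,
    ip x (a *: y + z) = a *: ip x y + ip x z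
}.

#[short(type="veType")]
HB.structure Definition VE (R : realType) (Z : orderedStarType R) :=
  {E of GRing.Lmodule R[i] E & Lmodule_isVE R Z E}.

Definition ptilde (R : realType) (Z : orderedStarType R) (E : veType Z)
    (p : Z -> R) (h : E) : R :=
  Num.sqrt (p (ip h h)).

Definition topology_defined_by (R : realType) (V : preTopologicalLmodType R[i])
    (Q : set (V -> R)) : Prop :=
  forall (x : V) (U : set V), nbhs x U <->
    exists (n : nat) (q : 'I_n -> V -> R) (e : R),
      [/\ 0 < e, forall i, Q (q i) &
          [set y | forall i, q i (y - x) < e] `<=` U].

HB.mixin Record VE_isTopVE (R : realType) (Z : topOrderedStarType R) E
    & Tvs R[i] E & VE R Z E := {
  hausdorffE : hausdorff_space E ;
  ve_topology : topology_defined_by [set @ptilde R Z E p | p in incr_seminorms Z]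
}.

#[short(type="topVEType")]
HB.structure Definition TopVE (R : realType) (Z : topOrderedStarType R) :=
  {E of Tvs R[i] E & VE R Z E & VE_isTopVE R Z E}.

(* Main.v *)
Require Import Defs.
From mathcomp Require Import all_boot all_order all_algebra.
From mathcomp Require Import all_classical all_reals all_analysis.
From mathcomp Require Import ring lra.

(** Polarization writes [4 *: ip x y] as a combination, with coefficients of
    modulus 1, of the four positive elements [g a = ip (a *: y + x) (a *: y + x)]
    for [a] ranging over [1], [-1], ['i], [- 'i]. By the parallelogram law
    [g a + g (- a) = 2 (ip x x + ip y y)], so each of the two positive terms lies
    below the right-hand side; as [p] is an increasing seminorm, each [p (g a)]
    is at most [2 (p (ip x x) + p (ip y y))]. Summing the four bounds gives
    [p (ip x y) <= 2 (p (ip x x) + p (ip y y))] ([seminorm_ip_le_sum]).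

    The right-hand side is not homogeneous in [y] whereas the left-hand side is:
    replacing [y] by [s *: y] for real [s >= 0] and optimizing over [s]
    ([discriminant_bound]) turns the arithmetic mean into the geometric one,
    [4 * sqrt (p (ip x x)) * sqrt (p (ip y y))]. Applying [p]
    before optimizing keeps that step in the reals: [Z] has no product, so the
    usual Cauchy-Schwarz argument cannot be run inside [Z]. *)

Import Order.TTheory GRing.Theory Num.Theory.
Local Open Scope ring_scope.

(** The hypothesis says that the quadratic [2 b s^2 - c s + 2 a] is nonnegative
    for [s >= 0]. If [b > 0], its vertex lies on that half-line, so its
    discriminant is nonpositive, that is [c^2 <= 16 a b]; if [b = 0], letting
    [s] grow forces [c = 0]. *)
Lemma discriminant_bound (R : realType) (a b c : R) :
  0 <= a -> 0 <= b -> 0 <= c ->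
  (forall s, 0 <= s -> s * c <= 2 * (a + s ^+ 2 * b)) ->
  c <= 4 * Num.sqrt a * Num.sqrt b.
Proof.
move=> a0 b0 c0 H.
rewrite -mulrA -sqrtrM // -(@ler_pXn2r _ 2) ?nnegrE ?mulr_ge0 ?sqrtr_ge0 //.
rewrite exprMn sqr_sqrtr ?mulr_ge0 //.
move: b0; rewrite le_eqVlt => /predU1P[b0|b0].
  rewrite -b0 !mulr0; move: c0; rewrite le_eqVlt => /predU1P[<-|c0].
    by rewrite expr0n.
  (* The quadratic is affine of slope [- c], negative once [s > 2 a / c]. *)
  have := H ((2 * a + 1) / c) (divr_ge0 _ (ltW c0)).
  by rewrite divfK ?gt_eqF // -b0 mulr0 addr0 => /(_ ltac:(lra)); lra.
(* [c / (4 b)] is the vertex. *)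
have := H (c / (4 * b)) (divr_ge0 c0 _) => /(_ ltac:(lra)).
have -> : c / (4 * b) * c = 4 * (c ^+ 2 / (16 * b)).
  by field; rewrite gt_eqF.
have -> : 2 * (a + (c / (4 * b)) ^+ 2 * b) = 2 * a + 2 * (c ^+ 2 / (16 * b)).
  by field; rewrite gt_eqF.
move=> h; have : c ^+ 2 / (16 * b) <= a by lra.
rewrite ler_pdivrMr; nra.
Qed.

Lemma conjc_i (R : realType) : ('i%C)^*%C = - 'i%C :> R[i].
Proof. by apply/eqP; rewrite eq_complex /= oppr0 !eqxx. Qed.

Section InnerProduct.
Context (R : realType) (Z : orderedStarType R) (E : veType Z).
Implicit Types (x y z : E) (a : R[i]).

Lemma ipD x y z : ip x (y + z) = ip x y + ip x z.
Proof. by have := ip_linear x 1 y z; rewrite !scale1r. Qed.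

Lemma ipZ a x y : ip x (a *: y) = a *: ip x y.
Proof.
have ip0 : ip x 0 = 0 by apply: (addrI (ip x 0)); rewrite -ipD !addr0.
by have := ip_linear x a y 0; rewrite ip0 !addr0.
Qed.

Lemma ip_conjlinear a x y z : ip (a *: y + z) x = (a^*)%C *: ip y x + ip z x.
Proof. by rewrite ip_star ip_linear star_conj_linear -!ip_star. Qed.

Lemma ip_scale a x : ip (a *: x) (a *: x) = (a * a^*%C) *: ip x x.
Proof.
have ip0 y : ip 0 y = 0.
  apply: (addrI (ip 0 y)); rewrite -[X in X + _]scale1r -(rmorph1 (@conjc R)).
  by rewrite -ip_conjlinear scaler0 !addr0.
by rewrite -[X in ip X]addr0 ip_conjlinear ip0 addr0 ipZ scalerA mulrC.
Qed.

Lemma ip_expand a x y : ip (a *: y + x) (a *: y + x) =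
  (a * a^*%C) *: ip y y + ip x x + (a *: ip x y + a^*%C *: ip y x).
Proof.
rewrite ip_conjlinear !ipD !ipZ scalerDr scalerA mulrC -!addrA; congr +%R.
by rewrite [LHS]addrC -!addrA addrCA.
Qed.

Lemma ip_parallelogram a x y : a * (a^*)%C = 1 ->
  ip (a *: y + x) (a *: y + x) + ip (- a *: y + x) (- a *: y + x)
  = (ip x x + ip y y) *+ 2.
Proof.
move=> a1; rewrite !ip_expand !rmorphN mulrNN a1 scale1r !scaleNr -opprD.
by rewrite addrACA subrr addr0 -mulr2n addrC.
Qed.

(** Subtracting the values at [a] and [- a] leaves only the cross terms
    [2 (a *: ip x y + a^* *: ip y x)]; the cases [a = 1] and [a = 'i] then
    combine so that [ip y x] cancels. *)
Lemma ip_polarization x y :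
  ip x y *+ 4 =
    (ip (1 *: y + x) (1 *: y + x) - ip (- 1 *: y + x) (- 1 *: y + x))
    - 'i%C *: (ip ('i%C *: y + x) ('i%C *: y + x)
             - ip (- 'i%C *: y + x) (- 'i%C *: y + x)).
Proof.
have D a : ip (a *: y + x) (a *: y + x) - ip (- a *: y + x) (- a *: y + x)
    = (a *: ip x y + a^*%C *: ip y x) *+ 2.
  rewrite !ip_expand !rmorphN mulrNN !scaleNr -opprD opprB.
  by rewrite [X in X + _]addrC addrACA subrr addr0 -mulr2n.
have ii : 'i%C * 'i%C = -1 :> R[i] by rewrite -expr2 sqr_i.
have -> : (4 = 2 + 2)%N by [].
rewrite !D rmorph1 !scale1r -scalerMnr scalerDr !scalerA ii -mulrnBl.
have -> : 'i%C * ('i%C)^*%C = 1 :> R[i] by rewrite conjc_i mulrN ii opprK.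
rewrite scale1r scaleN1r opprD opprK addrACA subrr addr0.
by rewrite mulrnDl mulrnDr.
Qed.

End InnerProduct.

Section Seminorm.
Context (R : realType) (V : lmodType R[i]) (p : V -> R) (pS : seminorm p).

(** Taking the modulus as a given real [r] keeps [p (a *: z)] in [R], whereas
    homogeneity in [seminorm] is an equation between complex numbers. *)
Lemma seminormZ (a : R[i]) (r : R) z : `|a| = r%:C%C -> p (a *: z) = r * p z.
Proof.
case: pS => _ _ pZ ar; apply: (@complexI R).
by rewrite pZ ar rmorphM.
Qed.

Lemma seminormMn z n : p (z *+ n) = p z *+ n.
Proof.
rewrite -scaler_nat (seminormZ _ n%:R) ?mulr_natl //.
by rewrite normr_nat rmorph_nat.
Qed.

Lemma seminormN z : p (- z) = p z.
Proof.
by rewrite -scaleN1r (seminormZ _ 1) ?mul1r // normrN1 rmorph1.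
Qed.

End Seminorm.

Section IncreasingSeminorm.
Context (R : realType) (Z : orderedStarType R) (E : veType Z) (p : Z -> R).
Context (pS : seminorm p) (pI : increasing p).
Implicit Types (x y : E).

Lemma increasing_leDl u v : zle 0 u -> zle 0 v -> p u <= p (u + v).
Proof.
by move=> u0 v0; apply: pI => //; rewrite /zle addrC addKr -[v]subr0.
Qed.

(** The two inner products are positive, so each is dominated by their sum,
    which the parallelogram law evaluates. *)
Lemma seminorm_ip_diff (a : R[i]) x y : a * (a^*)%C = 1 ->
  p (ip (a *: y + x) (a *: y + x) - ip (- a *: y + x) (- a *: y + x))
  <= (p (ip x x) + p (ip y y)) *+ 4.
Proof.
case: (pS) => _ pD _ a1; apply: le_trans (pD _ _) _; rewrite (seminormN _ _ _ pS).
set u := ip _ _; set v := ip (- a *: y + x) _.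
have uv : u + v = (ip x x + ip y y) *+ 2 by exact: ip_parallelogram.
have puv : p (u + v) <= (p (ip x x) + p (ip y y)) *+ 2.
  by rewrite uv (seminormMn _ _ _ pS) lerMn2r /=.
have -> : (4 = 2 + 2)%N by [].
rewrite mulrnDr; apply: lerD; apply: le_trans puv.
  by apply: increasing_leDl; exact: ip_ge0.
by rewrite addrC; apply: increasing_leDl; exact: ip_ge0.
Qed.

Lemma seminorm_ip_le_sum x y : p (ip x y) <= 2 * (p (ip x x) + p (ip y y)).
Proof.
case: (pS) => _ pD _.
have := pD (ip (1 *: y + x) (1 *: y + x) - ip (- 1 *: y + x) (- 1 *: y + x))
    (- ('i%C *: (ip ('i%C *: y + x) ('i%C *: y + x)
             - ip (- 'i%C *: y + x) (- 'i%C *: y + x)))).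
rewrite -ip_polarization (seminormN _ _ _ pS) (seminormMn _ _ _ pS) (seminormZ _ _ _ pS 'i%C 1); last first.
  by rewrite normc_def /= expr0n expr1n add0r sqrtr1.
have := seminorm_ip_diff 1 x y; rewrite rmorph1 mulr1 => /(_ erefl).
have := seminorm_ip_diff 'i%C x y.
rewrite conjc_i mulrN -expr2 sqr_i opprK => /(_ erefl).
lra.
Qed.

(** Scaling [y] by [s] multiplies [p (ip x y)] by [s] but [p (ip y y)] by
    [s ^+ 2], so the additive bound can be optimized over [s]. *)
Lemma seminorm_ip_bound x y :
  p (ip x y) <= 4 * Num.sqrt (p (ip x x)) * Num.sqrt (p (ip y y)).
Proof.
case: (pS) => p0 _ _; apply: discriminant_bound => // s s0.
have ns : `|s%:C%C| = s%:C%C :> R[i].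
  by apply: ger0_norm; rewrite ler0c.
have := seminorm_ip_le_sum x (s%:C%C *: y).
have -> : ip (s%:C%C *: y) (s%:C%C *: y) = (s ^+ 2)%:C%C *: ip y y.
  by rewrite ip_scale conjc_real -expr2 rmorphXn.
rewrite ipZ (seminormZ _ _ _ pS _ _ _ ns) (seminormZ _ _ _ pS _ (s ^+ 2)) //.
by rewrite rmorphXn normrX ns.
Qed.

End IncreasingSeminorm.

Theorem lemma2p2 (R : realType) (Z : topOrderedStarType R) (E : topVEType Z)
    (p : Z -> R) (hp : incr_seminorms Z p) (e f : E) :
  p (ip e f) <= 4 * Num.sqrt (p (ip e e)) * Num.sqrt (p (ip f f)) /\
  4 * Num.sqrt (p (ip e e)) * Num.sqrt (p (ip f f)) =
    4 * ptilde p e * ptilde p f.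
Proof.
by case: hp => pS pI _; split=> //; exact: seminorm_ip_bound.
Qed.
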